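(* Let $G=\{\mathbf u\in\mathbb R^N:\ g_i(\mathbf u)\succ 0,\ 1\le i\le I\}$ be convex with $\mathrm{int}(G)\neq\emptyset$. Suppose that the boundary of $G$ is piecewise $C^1$ (in the sense specified in the context, with $C^1$ pieces $\mathcal S_i$), and that, when $\mathbb I\ne\emptyset$, $$G\cap\Big(\bigcup_{\mathbf u_*\in\mathcal S_i}\{\mathbf u\in\mathbb R^N:\ (\mathbf u-\mathbf u_* )\cdot\mathbf n_{i*}=0\}\Big)=\emptyset\qquad\forall\, i\in\mathbb I .$$ Then $G=G_*$, where $$G_*=\Big\{\mathbf u\in\mathbb R^N:\ (\mathbf u-\mathbf u_* )\cdot\mathbf n_{i*}\succ 0\quad\forall\,\mathbf u_*\in\mathcal S_i,\ 1\le i\le I\Big\}.$$ Here ''$\succ$'' is taken as ''$>$'' if $i\in\mathbb I$ and as ''$\ge$'' if $i\in\widehat{\mathbb I}$, and the nonzero vector $\mathbf n_{i*}$ denotes an inward-pointing normal vector of $\mathcal S_i$ at $\mathbf u_*$.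
   Context: The index set $\{1,\dots,I\}$ is the disjoint union of $\mathbb I$ and $\widehat{\mathbb I}$; in the $i$-th constraint ''$\succ$'' means ''$>$'' if $i\in\mathbb I$ and ''$\ge$'' if $i\in\widehat{\mathbb I}$. The functions $g_i$ are not assumed concave, and $G$ need be neither open nor closed. Let $G_i:=\{\mathbf u\in\mathbb R^N:\ g_i(\mathbf u)\succ 0\}$ and $\mathcal S_i:=\partial G\cap\partial G_i$. ''The boundary of $G$ is piecewise $C^1$'' means: $\partial G=\bigcup_{1\le i\le I}\mathcal S_i$, each $\mathcal S_i$ is a $C^1$ hypersurface in $\mathbb R^N$ (a smooth piece of $\partial G$), and for each $i$ the function $g_i$ is $C^1$ at all points of $\mathcal S_i$. It is the paper's standing setting that the open region sets $G_i=\{g_i>0\}$ are open for $i\in\mathbb I$ and $G_i=\{g_i\ge 0\}$ are closed for $i\in\widehat{\mathbb I}$. A normal vector of $\mathcal S_i$ at $\mathbf u_*$ is inward-pointing if it points towards the side of $G$. The paper phrases the conclusion as ''$G$ has the GQL representation $G_*$'', meaning $G=G_*$ with $G_*$ described only by constraints affine in $\mathbf u$. *)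

(* Defs.v *)
From HB Require Import structures.
From mathcomp Require Import all_boot all_order all_algebra.
From mathcomp Require Import all_classical all_reals all_analysis.
Set Implicit Arguments.
Unset Strict Implicit.
Unset Printing Implicit Defensive.
Import Order.TTheory GRing.Theory Num.Theory.
Import numFieldNormedType.Exports.
Local Open Scope classical_set_scope.
Local Open Scope ring_scope.

Definition dot (R : realType) (N : nat) (u v : 'rV[R]_N) : R :=
  \sum_(j < N) u 0 j * v 0 j.

Definition boundary (T : topologicalType) (A : set T) : set T :=
  closure A `\` interior A.

(* In finite dimension, continuity at [u] of [v |-> 'd f v w] for every fixed
   [w] is continuity of the differential at [u]. *)
Definition C1_at (R : realType) (N : nat) (f : 'rV[R]_N -> R) (u : 'rV[R]_N)
    : Prop :=
  (\forall v \near u, differentiable f v) /\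
  (forall w : 'rV[R]_N, {for u, continuous (fun v => 'd f v w)}).

(* Points of [S] near which [S] contains the whole level set [phi = 0]. *)
Definition rel_interior (R : realType) (N : nat) (S : set 'rV[R]_N)
    (phi : 'rV[R]_N -> R) : set 'rV[R]_N :=
  [set p | S p /\ \forall v \near p, phi v = 0 -> S v].

(* Near [u], [S] is a piece of the regular C^1 level set [phi = 0]. A face of a
   domain has edges and corners, so [S] need not be the whole level set near
   [u]. The closure condition makes [S] of dimension N - 1 at [u], so the
   kernel of ['d phi u] does not depend on the choice of [phi]. *)
Definition C1_defining (R : realType) (N : nat) (S : set 'rV[R]_N)
    (phi : 'rV[R]_N -> R) (u : 'rV[R]_N) : Prop :=
  [/\ \forall v \near u, C1_at phi v,
      exists w : 'rV[R]_N, 'd phi u w != 0,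
      \forall v \near u, S v -> phi v = 0 &
      closure (rel_interior S phi) u].

(* C^1 hypersurface, possibly with edges and corners. *)
Definition C1_hypersurface (R : realType) (N : nat) (S : set 'rV[R]_N) : Prop :=
  forall u, S u -> exists phi, C1_defining S phi u.

(* Tangent vectors are taken in the full tangent hyperplane, also at the edges
   and corners of [S]. *)
Definition tangent_space (R : realType) (N : nat) (S : set 'rV[R]_N)
    (u : 'rV[R]_N) : set 'rV[R]_N :=
  [set w | exists phi, C1_defining S phi u /\ 'd phi u w = 0].

Definition normal_vector (R : realType) (N : nat) (S : set 'rV[R]_N)
    (u n : 'rV[R]_N) : Prop :=
  n != 0 /\ forall w, tangent_space S u w -> dot w n = 0.

(* [n] points to the side of [G]: it makes an acute angle with a direction that
   enters [G]. At a corner of [G], the ray from [u] along an inward normal of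
   one of the faces may itself leave [G]. *)
Definition inward_pointing (R : realType) (N : nat) (G : set 'rV[R]_N)
    (u n : 'rV[R]_N) : Prop :=
  exists d : 'rV[R]_N, 0 < dot d n /\ \forall t \near 0^'+, G (u + t *: d).

(* [Io] is the set of indices of the strict constraints, and its complement
   that of the weak ones: [0 < x ?<= if C] is [0 <= x] if [C], else [0 < x]. *)
Definition constraint_set (R : realType) (N m : nat) (Io : {set 'I_m})
    (g : 'I_m -> 'rV[R]_N -> R) (i : 'I_m) : set 'rV[R]_N :=
  [set u | 0 < g i u ?<= if (i \notin Io)].

Definition region (R : realType) (N m : nat) (Io : {set 'I_m})
    (g : 'I_m -> 'rV[R]_N -> R) : set 'rV[R]_N :=
  [set u | forall i, 0 < g i u ?<= if (i \notin Io)].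

Definition face (R : realType) (N m : nat) (Io : {set 'I_m})
    (g : 'I_m -> 'rV[R]_N -> R) (i : 'I_m) : set 'rV[R]_N :=
  boundary (region Io g) `&` boundary (constraint_set Io g i).

Definition piecewise_C1_boundary (R : realType) (N m : nat) (Io : {set 'I_m})
    (g : 'I_m -> 'rV[R]_N -> R) : Prop :=
  [/\ boundary (region Io g) = \bigcup_(i : 'I_m) face Io g i,
      forall i, C1_hypersurface (face Io g i) &
      forall i u, face Io g i u -> C1_at (g i) u].

Definition GQL_region (R : realType) (N m : nat) (Io : {set 'I_m})
    (g : 'I_m -> 'rV[R]_N -> R) (n : 'I_m -> 'rV[R]_N -> 'rV[R]_N)
    : set 'rV[R]_N :=
  [set u | forall i us, face Io g i us ->
     0 < dot (u - us) (n i us) ?<= if (i \notin Io)].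

(* Main.v *)
Require Import Defs.
From HB Require Import structures.
From mathcomp Require Import all_boot all_order all_algebra.
From mathcomp Require Import all_classical all_reals all_analysis.
From mathcomp Require Import lra.
Set Implicit Arguments.
Unset Strict Implicit.
Unset Printing Implicit Defensive.
Import Order.TTheory GRing.Theory Num.Theory.
Import numFieldNormedType.Exports.
Local Open Scope classical_set_scope.
Local Open Scope ring_scope.

(** Write G for the region, S_i for its faces, and n for the inward normals.

    Everything rests on one fact: at each point u of a face, the tangent
    hyperplane of the face supports G, that is, (x - u).n >= 0 for all x in G
    ([C1_piece_supports]). Suppose first that, near p, the face is the whole
    level set phi = 0. If interior points x and y of G lay strictly on
    opposite sides of the tangent hyperplane at p, then phi would have
    opposite signs at the two points p + t(x - p) and p + t(y - p), t small,
    so it would vanish somewhere on the segment joining them. But by convexity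
    that segment lies in the interior of G, whereas the zeros of phi near p
    lie on the boundary: a contradiction ([level_set_no_crossing]). At an edge
    or a corner u of the face, points p of the previous kind accumulate, and
    since the differential of phi is continuous, a strict separation at u
    would persist at such a p ([C1_piece_no_crossing]). The inward direction
    then selects the sign of n.

    The inclusion of G in the set of affine constraints is this support
    property; for the strict constraints, the tangency hypothesis excludes
    equality. Conversely, let u satisfy all the affine constraints. If u were
    outside the closure of G, the segment to u from an interior point x0 would
    cross the boundary at some us ([segment_meets_boundary]), on some face; the
    constraint there is strictly positive at x0 ([interior_dot_gt0]), hence
    negative at u, beyond us. So u lies in the closure of G. If it violated
    the i-th constraint, then i would be strict, since the weak constraint
    sets are closed; since the strict constraint sets are open, u would itself
    lie on the face S_i, and its own affine constraint would read 0 > 0. *)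

(** * Convex sets in normed modules *)

Section Convex.
Context {R : realType} {V : normedModType R}.
Implicit Types (A : set V) (p q u v w x y z : V) (t : R).

Lemma interior_sub_closure A : A° `<=` closure A.
Proof. exact: subset_trans (@interior_subset _ A) (@subset_closure _ A). Qed.

Lemma line_continuous p w : continuous (fun t : R => p + t *: w).
Proof.
move=> t; apply: cvgD; first exact: cvg_cst.
by apply: cvgZr_tmp; exact: cvg_id.
Qed.

Lemma affine_continuous t p : continuous (fun v => t *: v + p).
Proof.
move=> v; apply: cvgD; last exact: cvg_cst.
by apply: cvgZl_tmp; exact: cvg_id.
Qed.

Lemma convex_setE A x y t : convex_set A -> A x -> A y ->
  0 <= t <= 1 -> A (t *: x + (1 - t) *: y).
Proof.
move=> cA Ax Ay /andP[t0 t1].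
by have /[!inE] := cA x y (Itv01 t0 t1) (mem_set Ax) (mem_set Ay).
Qed.

(** With x' := x + c (p - q) and c := (1 - t) / t, the point
    z := p + t (x - p) is t x' + (1 - t) q for every q; choosing q in A so close
    to p that x' is still interior, the points near z are convex combinations
    of q and of points of A near x'. *)
Lemma interior_segment A x p t : convex_set A -> A° x -> closure A p ->
  0 < t <= 1 -> A° (p + t *: (x - p)).
Proof.
move=> cA Ax clp /andP[t0 t1].
pose c := t^-1 * (1 - t).
have tc : t * c = 1 - t by rewrite /c mulrA divff ?mul1r // gt_eqF.
have : nbhs p [set q | A° (- c *: q + (x + c *: p))].
  apply: (affine_continuous (t := - c) (p := x + c *: p)).
  by rewrite scaleNr addrC addrK; exact: nbhs_interior.
move=> /clp[q [Aq /= Ax']].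
have : nbhs (p + t *: (x - p)) [set z | A (t^-1 *: z + (- c *: q))].
  apply: affine_continuous.
  suff -> : t^-1 *: (p + t *: (x - p)) + - c *: q = - c *: q + (x + c *: p).
    by [].
  rewrite [LHS]addrC; congr (_ + _).
  rewrite scalerDr scalerA mulVf ?gt_eqF// scale1r /c mulrBr mulr1.
  by rewrite mulVf ?gt_eqF// scalerBl scale1r addrC addrA addrAC.
apply: filterS => z Az.
have -> : z = t *: (t^-1 *: z + - c *: q) + (1 - t) *: q.
  rewrite scalerDr !scalerA divff ?gt_eqF// scale1r mulrN tc.
  by rewrite scaleNr subrK.
by apply: convex_setE => //; rewrite ltW.
Qed.

Lemma line_near (B : set V) p w : nbhs p B ->
  \forall t \near (0:R)^'+, B (p + t *: w).
Proof.
have cv : p + t *: w @[t --> (0:R)^'+] --> p + 0 *: w.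
  by apply: cvg_at_right_filter; exact: line_continuous.
by move: cv; rewrite scale0r addr0; exact.
Qed.

Lemma subset_closure_interior A : convex_set A -> A° !=set0 ->
  A `<=` closure A°.
Proof.
move=> cA [x Ax] p Ap B /(line_near (x - p)) HB.
near (0:R)^'+ => t; exists (p + t *: (x - p)); split; last by near: t.
apply: interior_segment => //; first exact: subset_closure.
by apply/andP; split; near: t; [exact: nbhs_right_gt | exact: nbhs_right_le].
Unshelve. all: by end_near. Qed.

(** Otherwise the part of the segment in the closure of A would also be its
    part in the interior of A, hence open and closed in a connected set. *)
Lemma segment_meets_boundary A x y : A° x -> ~ closure A y ->
  exists2 t, 0 < t < 1 & boundary A (x + t *: (y - x)).
Proof.
move=> Ax Ay; apply: contrapT => noB.
pose f t := x + t *: (y - x).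
have f0 : f 0 = x by rewrite /f scale0r addr0.
have f1 : f 1 = y by rewrite /f scale1r addrC subrK.
have nB t : `[0, 1]%classic t -> ~ boundary A (f t).
  rewrite /= in_itv/= => /andP[t0 t1] B; apply: noB; exists t => //.
  rewrite !lt_neqAle t0 t1 !andbT.
  case: eqVneq B => [<-|_]; first by rewrite f0 => -[].
  by case: eqVneq => // ->; rewrite f1 => -[/Ay].
have cf : continuous f by exact: line_continuous.
have E : `[0, 1]%classic `&` f @^-1` closure A = `[0, 1]%classic.
  apply: (@segment_connected R 0 1 (_ `&` _)).
  - exists 0; split; first by rewrite /= in_itv/= lexx ler01.
    by rewrite /= f0; exact: interior_sub_closure.
  - exists (f @^-1` A°).
      by apply: open_comp; [move=> ? _; exact: cf | exact: open_interior].
    apply/seteqP; split=> t [It At]; split=> //.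
      by apply: contrapT => nt; exact: (nB t).
    exact: interior_sub_closure.
  - exists (f @^-1` closure A) => //.
    by apply: closed_comp; [move=> ? _; exact: cf | exact: closed_closure].
have : `[0, 1]%classic (1:R) by rewrite /= in_itv/= lexx ler01.
by rewrite -E => -[_]; rewrite /= f1.
Qed.

(** * Tangent hyperplanes of the boundary of a convex set *)

Lemma diff_gt0_near (phi : V -> R) p w : differentiable phi p -> phi p = 0 ->
  0 < 'd phi p w -> \forall t \near 0^'+, 0 < phi (p + t *: w).
Proof.
move=> dp p0 w0.
have cv : h^-1 *: ((phi \o shift p) (h *: w) - phi p) @[h --> 0^'+]
    --> 'd phi p w.
  by apply: cvg_dnbhs_at_right; rewrite -deriveE//; exact: diff_derivable.
have pos := cvgr_gt _ cv _ w0.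
near=> h.
have h0 : 0 < h by near: h; exact: nbhs_right_gt.
have : 0 < h^-1 *: ((phi \o shift p) (h *: w) - phi p) by near: h; exact: pos.
by rewrite p0 subr0 /= addrC pmulr_rgt0 // invr_gt0.
Unshelve. all: by end_near. Qed.

Lemma diff_lt0_near (phi : V -> R) p w : differentiable phi p -> phi p = 0 ->
  'd phi p w < 0 -> \forall t \near 0^'+, phi (p + t *: w) < 0.
Proof.
move=> dp p0 w0.
have := @diff_gt0_near (- phi) p w (differentiableN dp).
rewrite diffN//= => /(_ _ _)/= H.
have {}H : \forall t \near 0^'+, 0 < (- phi) (p + t *: w).
  by apply: H; rewrite ?oppr_gt0 // /GRing.opp /= p0 oppr0.
by apply: filterS H => t; rewrite -oppr_gt0.
Qed.

(** The segment joining p + t (x - p) to p + t (y - p) lies in the interior of A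
    and, for t small, in a ball where the zeros of phi avoid that interior;
    yet phi has opposite signs at its ends. *)
Lemma level_set_no_crossing A (phi : V -> R) p x y : convex_set A ->
  closure A p -> phi p = 0 -> (\forall v \near p, differentiable phi v) ->
  (\forall v \near p, phi v = 0 -> ~ A° v) ->
  A° x -> A° y -> 'd phi p (x - p) < 0 -> 0 < 'd phi p (y - p) -> False.
Proof.
move=> cA clp p0 dphi noA Ax Ay lx ly.
have dp : differentiable phi p by exact: nbhs_singleton dphi.
have [r /= r0 rP] : exists2 r : R, 0 < r & forall v, `|p - v| < r ->
    differentiable phi v /\ (phi v = 0 -> ~ A° v).
  have /nbhs_normP[r /= r0 rP] : \forall v \near p, differentiable phi v /\
      (phi v = 0 -> ~ A° v) by apply: filterI.
  by exists r => // v pv; exact: rP.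
(* The distance from p to h s below is at most t M. *)
pose M := `|x - p| + `|y - p| + 1.
have M0 : 0 < M by rewrite /M ltr_wpDl.
near (0:R)^'+ => t.
have t0 : 0 < t by near: t; exact: nbhs_right_gt.
have t1 : t <= 1 by near: t; exact: nbhs_right_le.
have tr : t < r / M by near: t; apply: nbhs_right_lt; rewrite divr_gt0.
pose z (s : R) := x - p + s *: (y - x).
pose h (s : R) := p + t *: z s.
have zE s : z s = s *: (y - p) + (1 - s) *: (x - p).
  rewrite /z scalerBl scale1r addrCA -scalerBr; congr (_ + _ *: _).
  by rewrite opprB addrA subrK.
have h_near s : 0 <= s <= 1 -> `|p - h s| < r.
  move=> /andP[s0 s1].
  rewrite /h opprD addrA subrr add0r normrN normrZ gtr0_norm//.
  move: tr; rewrite ltr_pdivlMr// => tr.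
  apply: le_lt_trans tr; rewrite ler_pM2l// zE.
  apply: (le_trans (ler_normD _ _)); rewrite !normrZ /M.
  rewrite (ger0_norm s0) ger0_norm ?subr_ge0//.
  have := normr_ge0 (x - p); have := normr_ge0 (y - p).
  by move: `|x - p| `|y - p| => a b a0 b0; nra.
have hA s : 0 <= s <= 1 -> A° (h s).
  move=> s01; rewrite /h.
  have -> : z s = (x + s *: (y - x)) - p by rewrite /z addrAC.
  apply: interior_segment => //; last by rewrite t0.
  have [->|s0] := eqVneq s 0; first by rewrite scale0r addr0.
  apply: interior_segment => //; last by rewrite lt_neqAle eq_sym s0.
  exact: interior_sub_closure.
have ch : continuous h.
  move=> s; apply: cvgD; first exact: cvg_cst.
  by apply: cvgZl_tmp; exact: line_continuous.
have hx : phi (h 0) < 0.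
  rewrite /h /z scale0r addr0; near: t; exact: diff_lt0_near.
have hy : 0 < phi (h 1).
  rewrite /h zE subrr scale0r addr0 scale1r; near: t; exact: diff_gt0_near.
have [||s] := @IVT R (phi \o h) 0 1 0 ler01.
- apply: continuous_in_subspaceT => s; rewrite inE /= in_itv /= => s01.
  apply: continuous_comp; first exact: ch.
  by apply: differentiable_continuous; case: (rP _ (h_near _ s01)).
- by rewrite ge_min le_max /= (ltW hx) (ltW hy) orbT.
rewrite in_itv /= => s01 phis.
by case: (rP _ (h_near _ s01)) => _ /(_ phis); apply; exact: hA.
Unshelve. all: by end_near. Qed.

End Convex.

Section Euclidean.
Context {R : realType} {N : nat}.
Implicit Types (u v w : 'rV[R]_N).

Lemma dotDl u v w : dot (u + v) w = dot u w + dot v w.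
Proof.
by rewrite /dot -big_split; apply: eq_bigr => j _; rewrite mxE mulrDl.
Qed.

Lemma dotZl a u w : dot (a *: u) w = a * dot u w.
Proof.
by rewrite /dot mulr_sumr; apply: eq_bigr => j _; rewrite mxE mulrA.
Qed.

Lemma dotNl u w : dot (- u) w = - dot u w.
Proof. by rewrite -scaleN1r dotZl mulN1r. Qed.

Lemma dotBl u v w : dot (u - v) w = dot u w - dot v w.
Proof. by rewrite dotDl dotNl. Qed.

Lemma dot_gt0 w : w != 0 -> 0 < dot w w.
Proof.
move=> w0; rewrite lt_neqAle sumr_ge0 ?andbT; last first.
  by move=> j _; exact: sqr_ge0.
apply: contra w0 => /eqP /esym /eqP; rewrite psumr_eq0; last first.
  by move=> j _; exact: sqr_ge0.
move=> /allP w0; apply/eqP/rowP => j; rewrite mxE.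
by have /(_ (mem_index_enum j)) := w0 j; rewrite mulf_eq0 orbb => /eqP.
Qed.

Lemma cvg_sum_ord {T : Type} (F : set_system T) {FF : Filter F}
    (f : 'I_N -> T -> R) (a : 'I_N -> R) :
  (forall j, f j x @[x --> F] --> a j) ->
  \sum_j f j x @[x --> F] --> \sum_j a j.
Proof. by move=> fa; apply: cvg_big => [|j _]; [exact: add_continuous|]. Qed.

Lemma dot_continuous w : continuous (fun u => dot u w).
Proof.
move=> u; apply: (@cvg_sum_ord _ (nbhs u)) => j.
by apply: cvgM; [exact: coord_continuous | exact: cvg_cst].
Qed.

(** A form vanishing on the kernel of l is a multiple of l: this identifies
    the normals of a level set with the multiples of its gradient. *)
Lemma dot_proportional (l : {linear 'rV[R]_N -> R}) w n :
  l w != 0 -> (forall v, l v = 0 -> dot v n = 0) ->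
  forall v, dot v n = dot w n / l w * l v.
Proof.
move=> lw0 ln v.
have : dot (v - (l v / l w) *: w) n = 0.
  have lE : l (v - (l v / l w) *: w) = l v - l v / l w * l w.
    by rewrite linearB linearZ.
  by apply: ln; rewrite lE divfK ?subrr.
rewrite dotBl dotZl => /eqP; rewrite subr_eq0 => /eqP ->.
by rewrite mulrC [l v / _]mulrC mulrA.
Qed.

(** Continuity of p |-> 'd phi p w for fixed w suffices although the direction
    x - p moves with p, because the direction can be expanded in the basis. *)
Lemma diff_joint_continuous (phi : 'rV[R]_N -> R) (u x : 'rV[R]_N) :
  C1_at phi u -> 'd phi p (x - p) @[p --> u] --> 'd phi u (x - u).
Proof.
move=> [_ C].
pose F (p : 'rV[R]_N) := \sum_j (x 0 j - p 0 j) * 'd phi p (delta_mx 0 j).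
have E : (fun p : 'rV[R]_N => 'd phi p (x - p)) = F.
  apply/funext => p; rewrite [in LHS](row_sum_delta (x - p)) linear_sum.
  by apply: eq_bigr => j _; rewrite linearZ !mxE.
have cv : F @ u --> F u.
  apply: (@cvg_sum_ord _ (nbhs u) _ (fun j p => _ * _)) => j.
  apply: cvgM; last exact: C.
  by apply: cvgB; [exact: cvg_cst | exact: coord_continuous].
by rewrite -E in cv.
Qed.

(** Strict inequalities at u persist nearby, in particular at points where the
    piece is the whole level set. *)
Lemma C1_piece_no_crossing (A S : set 'rV[R]_N) phi (u x y : 'rV[R]_N) :
  convex_set A -> S `<=` boundary A -> C1_defining S phi u ->
  A° x -> A° y -> 'd phi u (x - u) < 0 -> 0 < 'd phi u (y - u) -> False.
Proof.
move=> cA SA [C1 _ S0 clu] Ax Ay lx ly.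
have C1u := nbhs_singleton C1.
have Hx : \forall p \near u, 'd phi p (x - p) < 0.
  exact: cvgr_lt (diff_joint_continuous C1u) _ lx.
have Hy : \forall p \near u, 0 < 'd phi p (y - p).
  exact: cvgr_gt (diff_joint_continuous C1u) _ ly.
have [p [[Sp pS] [[px py] [S0p C1p]]]] :=
  clu _ (filterI (filterI Hx Hy) (filterI S0 (near_join C1))).
apply: (@level_set_no_crossing _ _ A phi p x y) => //.
- by case: (SA _ Sp).
- exact: S0p.
- by apply: filterS C1p => v [/nbhs_singleton].
- by apply: filterS pS => v vS /vS /SA[].
Qed.

(** On the interior of A, (. - u).n is a multiple of 'd phi u, hence does not
    take both signs; the inward direction d shows that it takes the positive
    one. *)
Lemma C1_piece_supports (A S : set 'rV[R]_N) (u n x : 'rV[R]_N) :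
  convex_set A -> A° !=set0 -> S `<=` boundary A -> C1_hypersurface S ->
  S u -> normal_vector S u n -> inward_pointing A u n ->
  A x -> 0 <= dot (x - u) n.
Proof.
move=> cA A0 SA CS Su [n0 nT] [d [dn dA]] Ax.
have [phi phiP] := CS _ Su.
have [_ [w w0] _ _] := phiP.
have nE v : dot v n = dot w n / 'd phi u w * 'd phi u v.
  by apply: dot_proportional => // v' l0; apply: nT; exists phi.
rewrite leNgt; apply/negP => xn.
(* Points of A where a strict sign occurs may be moved into the interior. *)
have [x' [Ax' x'n]] : A° `&` [set v | dot v n < dot u n] !=set0.
  apply: subset_closure_interior Ax _ _ => //.
  rewrite dotBl subr_lt0 in xn.
  exact: (cvgr_lt _ (@dot_continuous n x) _ xn).
have [y' [Ay' y'n]] : A° `&` [set v | dot u n < dot v n] !=set0.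
  near (0:R)^'+ => t.
  have Ay : A (u + t *: d) by near: t.
  have yn : dot u n < dot (u + t *: d) n.
    by rewrite dotDl dotZl ltrDl mulr_gt0//; near: t; exact: nbhs_right_gt.
  apply: subset_closure_interior Ay _ _ => //.
  exact: (cvgr_gt _ (@dot_continuous n _) _ yn).
have xl : dot (x' - u) n < 0 by rewrite dotBl subr_lt0.
have yl : 0 < dot (y' - u) n by rewrite dotBl subr_gt0.
rewrite nE in xl; rewrite nE in yl.
have [c0|c0|c0] := ltgtP (dot w n / 'd phi u w) 0.
- rewrite nmulr_rlt0// in xl; rewrite nmulr_rgt0// in yl.
  exact: (C1_piece_no_crossing cA SA phiP Ay' Ax').
- rewrite pmulr_rlt0// in xl; rewrite pmulr_rgt0// in yl.
  exact: (C1_piece_no_crossing cA SA phiP Ax' Ay').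
- by rewrite c0 mul0r ltxx in yl.
Unshelve. all: by end_near. Qed.

(** An interior point can be moved against n without leaving A. *)
Lemma interior_dot_gt0 (A : set 'rV[R]_N) (u n x : 'rV[R]_N) : n != 0 ->
  (forall y, A y -> 0 <= dot (y - u) n) -> A° x -> 0 < dot (x - u) n.
Proof.
move=> n0 An Ax; near (0:R)^'+ => t.
have t0 : 0 < t by near: t; exact: nbhs_right_gt.
have : A (x + t *: - n) by near: t; exact: line_near.
have -> : x + t *: - n = x + (- t) *: (n : 'rV[R]_N) by rewrite scalerN scaleNr.
move=> /An; rewrite addrAC [dot (x - u + _) _]dotDl dotZl mulNr subr_ge0.
by apply: lt_le_trans; rewrite mulr_gt0// dot_gt0.
Unshelve. all: by end_near. Qed.

End Euclidean.

(** * The affine representation of the region *)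

Theorem theorem3p10 (R : realType) (N m : nat) (Io : {set 'I_m})
    (g : 'I_m -> 'rV[R]_N -> R) (n : 'I_m -> 'rV[R]_N -> 'rV[R]_N)
    (openG : forall i, i \in Io -> open (constraint_set Io g i))
    (closedG : forall i, i \notin Io -> closed (constraint_set Io g i))
    (convexG : convex_set (region Io g))
    (intG : interior (region Io g) !=set0)
    (C1G : piecewise_C1_boundary Io g)
    (n_normal : forall i us, face Io g i us ->
       normal_vector (face Io g i) us (n i us) /\
       inward_pointing (region Io g) us (n i us))
    (tangentG : forall i, i \in Io ->
       region Io g `&`
         \bigcup_(us in face Io g i)
           [set u : 'rV[R]_N | dot (u - us) (n i us) = 0] = set0) :
  region Io g = GQL_region Io g n.
Proof.
set G := region Io g in convexG intG n_normal tangentG *.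
have [bdG C1F _] := C1G.
have supp i us u : face Io g i us -> G u -> 0 <= dot (u - us) (n i us).
  move=> Fus; have [nus inus] := n_normal _ _ Fus.
  by apply: (@C1_piece_supports _ _ G (face Io g i)) => // v [].
apply/seteqP; split=> [u Gu i us Fus|u Gu].
  have [iIo|iIo] := boolP (i \in Io); last exact: supp Fus Gu.
  rewrite /= lt_neqAle (supp _ _ _ Fus Gu) andbT eq_sym; apply/eqP => eq0.
  suff : (set0 : set 'rV[R]_N) u by [].
  by rewrite -(tangentG i iIo); split => //; exists us.
(* us divides the segment from x0 to u, so x0 - us and u - us are opposite. *)
have clG : closure G u.
  apply: contrapT => nclG; have [x0 Gx0] := intG.
  have [t /andP[t0 t1]] := segment_meets_boundary Gx0 nclG.
  rewrite bdG => -[i _ Fus].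
  set us := x0 + _ in Fus.
  have [[n0 _] _] := n_normal _ _ Fus.
  have x0n : 0 < dot (x0 - us) (n i us).
    by apply: interior_dot_gt0 Gx0 => // y; exact: supp.
  have un : 0 <= dot (u - us) (n i us).
    by have := Gu i us Fus; case: (i \notin Io) => // /ltW.
  have x0E : x0 - us = - t *: (u - x0).
    by rewrite /us opprD addNKr scaleNr.
  have uE : u - us = (1 - t) *: (u - x0).
    by rewrite /us opprD addrA scalerBl scale1r.
  move: x0n un; rewrite x0E uE !dotZl.
  by move: (dot _ _) => e; nra.
move=> i; apply: contrapT => nGi.
have clGi : closure (constraint_set Io g i) u.
  by apply: closureS clG => v; exact.
have [iIo|iIo] := boolP (i \in Io); last exact/nGi/closedG.
have Fu : face Io g i u.
  split; split=> //; last by move=> /interior_subset.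
  by move=> /interior_subset /(_ i).
have := Gu i u Fu; rewrite iIo subrr /= /dot big1 ?ltxx// => j _.
by rewrite mxE mul0r.
Qed.
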